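(* Let $X$ be a Banach space. The following assertions are equivalent: (1) For every Banach space $Y$, every subspace $H\subseteq L(X,Y)$ with $\mathcal F(X,Y)\subseteq H$ is octahedral. (2) For every Banach space $Y$, $L(X,Y)$ is octahedral. (3) $X^*$ is universally octahedral, i.e. for every Banach space $Y$, $L(Y,X^* )$ is octahedral. (4) For every $\varepsilon>0$, every finite-dimensional subspace $Z$ of $X^*$ and every $n\in\mathbb N$, there exists an operator $T:\ell_\infty^n\to X^*$ with $\|T\|\le 1$ such that $\|z+T(y)\|\ge(1-\varepsilon)(\|z\|+\|y\|)$ for every $y\in\ell_\infty^n$ and every $z\in Z$.
   Context: All Banach spaces are real. $L(X,Y)$ is the space of bounded linear operators with the operator norm, and $\mathcal F(X,Y)$ is its subspace of finite-rank operators. A Banach space $W$ is octahedral if for every $x_1,\dots,x_n\in S_W$ and $\varepsilon>0$ there is $y\in S_W$ with $\|x_i-y\|\ge 2-\varepsilon$ for all $i$. $\ell_\infty^n$ is $\mathbb R^n$ with the max norm.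
   Formalization: The Banach space X is assumed nonzero: for X = {0}, assertions (1)–(3) hold vacuously (the unit spheres are empty) while (4) fails with n = 1, Z = {0}, ε < 1 and y ≠ 0. *)

(* Defs.v *)
From HB Require Import structures.
From mathcomp Require Import all_boot all_order all_algebra.
From mathcomp Require Import all_classical all_reals all_analysis.
Import Order.TTheory GRing.Theory Num.Theory numFieldNormedType.Exports.

Set Implicit Arguments.
Unset Strict Implicit.
Unset Printing Implicit Defensive.

Local Open Scope classical_set_scope.
Local Open Scope ring_scope.

Section Defs.
Variable R : realType.

Definition is_lin (U V : lmodType R) (T : U -> V) : Prop :=
  forall (a : R) (x y : U), T (a *: x + y) = a *: T x + T y.

Definition is_bdd (X : normedModType R) (V : lmodType R) (nV : V -> R)
  (T : X -> V) : Prop :=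
  exists M : R, forall x : X, nV (T x) <= M * `|x|.

Definition bdd_op (X : normedModType R) (V : lmodType R) (nV : V -> R)
  (T : X -> V) : Prop := is_lin T /\ is_bdd nV T.

Definition op_norm (X : normedModType R) (V : lmodType R) (nV : V -> R)
  (T : X -> V) : R := sup [set nV (T x) | x in [set x : X | `|x| <= 1]].

Definition Lop (X Y : normedModType R) : set (X -> Y) :=
  [set T | bdd_op (fun y : Y => `|y|) T].


Definition opn (X Y : normedModType R) (T : X -> Y) : R :=
  op_norm (fun y : Y => `|y|) T.

Definition finite_rank (X Y : normedModType R) (T : X -> Y) : Prop :=
  exists (k : nat) (v : 'I_k -> Y),
    forall x : X, exists c : 'I_k -> R, T x = \sum_(i < k) c i *: v i.

Definition Fop (X Y : normedModType R) : set (X -> Y) :=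
  [set T | @Lop X Y T /\ finite_rank T].


Definition lsubspace (V : lmodType R) (H : set V) : Prop :=
  H 0 /\ forall (a : R) (x y : V), H x -> H y -> H (a *: x + y).

Definition octahedral (V : lmodType R) (N : V -> R) (W : set V) : Prop :=
  forall (n : nat) (x : 'I_n.+1 -> V) (eps : R), 0 < eps ->
    (forall i, W (x i) /\ N (x i) = 1) ->
    exists y : V, W y /\ N y = 1 /\ forall i, 2 - eps <= N (x i - y).

Definition dual (X : normedModType R) : set (X -> R) :=
  [set f | bdd_op (fun r : R => `|r|) f].

Definition dual_norm (X : normedModType R) (f : X -> R) : R :=
  op_norm (fun r : R => `|r|) f.

Definition Lop_dual (Y X : normedModType R) : set (Y -> (X -> R)) :=
  [set S | (forall y, @dual X (S y)) /\ bdd_op (@dual_norm X) S].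


Definition opn_dual (Y X : normedModType R) (S : Y -> (X -> R)) : R :=
  op_norm (@dual_norm X) S.

Definition findim_dual_subspace (X : normedModType R) (Z : set (X -> R)) : Prop :=
  exists (k : nat) (f : 'I_k -> (X -> R)), (forall i, @dual X (f i)) /\
    Z = [set g | exists c : 'I_k -> R, g = \sum_(i < k) c i *: f i].

End Defs.

Arguments Lop {R} X Y.
Arguments Fop {R} X Y.
Arguments dual {R} X.
Arguments Lop_dual {R} Y X.

(* Main.v *)
(* (2) => (3) is the isometry L(Y, X^* ) = L(X, Y^* ), applied with a dual space as target.

   (3) => (4): renorm R^n by sqrt (|y|_oo^2 + d |y|_2^2), which is close to the max
   norm for small d and whose unit sphere consists of exposed points: each y has an
   explicit support functional f_y with f_y(x) near 1 only for x near y.  If T is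
   almost at distance 2 from all the rank-one operators x |-> f_y(x) z, for z and y in
   finite nets of the unit spheres of Z and of R^n, then the norm of f_y(.) z - T is
   almost attained near +-y, so |z - T y| is almost 2 for all unit z and y.

   (4) => (1): given S_1, ..., S_n of norm 1, choose x_i in the unit ball with
   |S_i x_i| almost 1 and y_i^* norming S_i x_i, and apply (4) to the span of the
   functionals z_i = y_i^* o S_i.  The operator U : l_oo^n -> X^* so obtained yields
   the finite-rank contraction T x = \sum_j (U e_j)(x) S_j x_j, and
   y_i^* o (S_i + T) = z_i + U (y_i^* (S_j x_j))_j has norm almost 2. *)
Require Import Defs.
From HB Require Import structures.
From mathcomp Require Import all_boot all_order all_algebra.
From mathcomp Require Import all_classical all_reals all_analysis.
From mathcomp Require Import ring lra.
Import Order.TTheory GRing.Theory Num.Theory numFieldNormedType.Exports.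
Local Open Scope classical_set_scope.
Local Open Scope ring_scope.

Set Implicit Arguments.
Unset Strict Implicit.
Unset Printing Implicit Defensive.

(** * Bounded operators and the operator norm *)

Section BoundedOperators.
Context {R : realType}.

Section Linear.
Context {U V : lmodType R}.
Variables (T : U -> V) (linT : is_lin T).

Lemma is_lin0 : T 0 = 0.
Proof.
have /eqP := linT 1 0 0.
by rewrite !scale1r addr0 -subr_eq0 opprD addrA subrr sub0r oppr_eq0 => /eqP.
Qed.

Lemma is_linD x y : T (x + y) = T x + T y.
Proof. by rewrite -[x]scale1r linT !scale1r. Qed.

Lemma is_linZ a x : T (a *: x) = a *: T x.
Proof. by rewrite -[a *: x]addr0 linT is_lin0 addr0. Qed.

Lemma is_linN x : T (- x) = - T x.
Proof. by rewrite -scaleN1r is_linZ scaleN1r. Qed.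

Lemma is_linB x y : T (x - y) = T x - T y.
Proof. by rewrite is_linD is_linN. Qed.

Lemma is_lin_sum (I : Type) (r : seq I) (F : I -> U) :
  T (\sum_(i <- r) F i) = \sum_(i <- r) T (F i).
Proof.
elim: r => [|i r IH]; first by rewrite !big_nil is_lin0.
by rewrite !big_cons is_linD IH.
Qed.

End Linear.

Section OperatorNorm.
Context {A B : normedModType R}.
Implicit Type T : A -> B.

Lemma LopP T (M : R) : is_lin T -> (forall x, `|T x| <= M * `|x|) -> Lop A B T.
Proof. by move=> linT TM; split => //; exists M. Qed.

Let image_ball T : Lop A B T ->
  has_ubound [set `|T x| | x in [set x : A | `|x| <= 1]].
Proof.
move=> [_ [M TM]]; exists (Num.max M 0) => _ [x /= x1 <-].
apply: le_trans (TM x) _; rewrite -[leRHS]mulr1.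
apply: (@le_trans _ _ (Num.max M 0 * `|x|)).
  by rewrite ler_wpM2r// le_max lexx.
by rewrite ler_wpM2l// le_max lexx orbT.
Qed.

Let image_ball_neq0 T : [set `|T x| | x in [set x : A | `|x| <= 1]] !=set0.
Proof. by exists `|T 0|; exists 0 => //=; rewrite normr0. Qed.

Lemma opn_le1 T x : Lop A B T -> `|x| <= 1 -> `|T x| <= opn T.
Proof. by move=> LT x1; apply: ub_le_sup; [exact: image_ball | exists x]. Qed.

Lemma opn_ub T (M : R) : (forall x, `|x| <= 1 -> `|T x| <= M) -> opn T <= M.
Proof. by move=> TM; apply: ge_sup => // _ [x /= x1 <-]; exact: TM. Qed.

Lemma opn_gt T (M : R) : M < opn T -> exists2 x, `|x| <= 1 & M < `|T x|.
Proof. by move=> /sup_gt[//|_ [x x1 <-] MTx]; exists x. Qed.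

Lemma opn_ge0 T : Lop A B T -> 0 <= opn T.
Proof.
move=> LT; apply: le_trans (opn_le1 LT (x := 0) _) => //.
by rewrite normr0.
Qed.

Lemma opn_le T x : Lop A B T -> `|T x| <= opn T * `|x|.
Proof.
move=> LT; have [->|x0] := eqVneq x 0.
  by rewrite (is_lin0 LT.1) !normr0 mulr0.
have nx : 0 < `|x| by rewrite normr_gt0.
rewrite -ler_pdivrMr// mulrC.
have <- : `|T (`|x|^-1 *: x)| = `|x|^-1 * `|T x|.
  by rewrite (is_linZ LT.1) normrZ ger0_norm// invr_ge0.
apply: opn_le1 => //; rewrite normrZ ger0_norm ?invr_ge0//.
by rewrite mulVf// gt_eqF.
Qed.

Lemma opn_ubM T (M : R) : 0 <= M -> (forall x, `|T x| <= M * `|x|) -> opn T <= M.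
Proof.
by move=> M0 TM; apply: opn_ub => x x1; rewrite (le_trans (TM x))// ler_piMr.
Qed.

Lemma Lop0 : Lop A B 0.
Proof.
apply: (@LopP _ 0) => [a x y|x].
  by change ((0 : B) = a *: 0 + 0); rewrite scaler0 addr0.
by change (`|0 : B| <= 0 * `|x|); rewrite normr0 mul0r.
Qed.

Lemma LopZD a S T : Lop A B S -> Lop A B T -> Lop A B (a *: S + T).
Proof.
move=> LS LT; apply: (@LopP _ (`|a| * opn S + opn T)) => [b x y|x].
  rewrite !fctE (LS.1 b) (LT.1 b) !scalerDr !scalerA (mulrC a) !addrA.
  by congr (_ + _); rewrite addrAC.
rewrite !fctE mulrDl (le_trans (ler_normD _ _))// lerD ?opn_le//.
by rewrite normrZ -mulrA ler_wpM2l// opn_le.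
Qed.

Lemma LopD S T : Lop A B S -> Lop A B T -> Lop A B (S + T).
Proof. by move=> LS LT; rewrite -[S]scale1r; exact: LopZD. Qed.

Lemma LopZ a S : Lop A B S -> Lop A B (a *: S).
Proof. by move=> LS; rewrite -[_ *: _]addr0; apply: LopZD => //; exact: Lop0. Qed.

Lemma LopN S : Lop A B S -> Lop A B (- S).
Proof. by move=> LS; rewrite -scaleN1r; exact: LopZ. Qed.

Lemma LopB S T : Lop A B S -> Lop A B T -> Lop A B (S - T).
Proof. by move=> LS LT; apply: LopD => //; exact: LopN. Qed.

Lemma opnD S T : Lop A B S -> Lop A B T -> opn (S + T) <= opn S + opn T.
Proof.
move=> LS LT; apply: opn_ub => x x1; rewrite fctE.
by rewrite (le_trans (ler_normD _ _))// lerD// opn_le1.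
Qed.

Lemma opnZ a T : Lop A B T -> opn (a *: T) = `|a| * opn T.
Proof.
have le b S : Lop A B S -> opn (b *: S) <= `|b| * opn S.
  move=> LS; apply: opn_ub => x x1; rewrite fctE normrZ.
  by rewrite ler_wpM2l// opn_le1.
move=> LT; apply/eqP; rewrite eq_le le//=.
have [->|a0] := eqVneq a 0.
  by rewrite normr0 mul0r opn_ge0//; exact: LopZ.
rewrite -[T in leLHS]scale1r -(mulVf a0) -scalerA.
rewrite -ler_pdivlMl ?normr_gt0// -normfV.
by apply: le; exact: LopZ.
Qed.

Lemma opn_eq0 T : Lop A B T -> opn T = 0 -> T = 0.
Proof.
move=> LT T0; apply/funext => x; apply/normr0_eq0/le_anti.
by rewrite normr_ge0 andbT (le_trans (opn_le x LT))// T0 mul0r.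
Qed.

End OperatorNorm.

Section OperatorSpace.
Variables A B : normedModType R.

Definition Lop_pred : {pred A -> B} := [pred T | `[< Lop A B T >]].

Lemma Lop_predE T : (T \in Lop_pred) <-> Lop A B T.
Proof. by split=> [/asboolP|H]//; apply/asboolP. Qed.

Lemma Lop_submod_closed : submod_closed Lop_pred.
Proof.
split; first exact/Lop_predE/Lop0.
by move=> a S T /Lop_predE LS /Lop_predE LT; exact/Lop_predE/LopZD.
Qed.

HB.instance Definition _ :=
  GRing.isSubmodClosed.Build R (A -> B) Lop_pred Lop_submod_closed.

(** Bundling makes operator spaces normed modules, so that the dual [opSp X R] can itself be the
    target of operators. *)
Record opSp := OpSp { opfun :> A -> B ; opfunP : opfun \in Lop_pred }.

HB.instance Definition _ := [isSub for opfun].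
HB.instance Definition _ := [Choice of opSp by <:].
HB.instance Definition _ := [SubChoice_isSubLmodule of opSp by <:].

Definition mk_op T (LT : Lop A B T) : opSp := OpSp ((Lop_predE T).2 LT).

Lemma opfun_Lop (T : opSp) : Lop A B T.
Proof. exact/Lop_predE/opfunP. Qed.

Lemma ler_opnD (S T : opSp) : opn (S + T : opSp) <= opn S + opn T.
Proof. by apply: opnD; exact: opfun_Lop. Qed.

Lemma opn_scale (a : R) (T : opSp) : opn (a *: T : opSp) = `|a| * opn T.
Proof. by apply: opnZ; exact: opfun_Lop. Qed.

Lemma opn_opfun_eq0 (T : opSp) : opn T = 0 -> T = 0.
Proof.
by move=> T0; apply/val_inj/opn_eq0 => //; exact: opfun_Lop.
Qed.

HB.instance Definition _ := @Lmodule_isNormed.Build R opSp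
  (fun T : opSp => opn T) ler_opnD opn_scale opn_opfun_eq0.

Lemma norm_opSpE (T : opSp) : `|T| = opn T.
Proof. by []. Qed.

End OperatorSpace.
End BoundedOperators.

(** * Completeness of operator spaces *)

Section OperatorSpaceComplete.
Context {R : realType} (A : normedModType R) (B : completeNormedModType R).

(** Dual spaces must be complete to be admissible targets in assertion (2). A Cauchy filter has a
    pointwise limit, and the bounds on its balls pass to that limit uniformly. *)
Lemma opSp_complete (F : set_system (opSp A B)) :
  ProperFilter F -> cauchy F -> cvg F.
Proof.
move=> FF /cauchyP Fc.
have evc x : cauchy ((fun T : opSp A B => T x) @ F).
  (* The added 1 keeps the radius [e / (|x| + 1)] meaningful at [x = 0]. *)
  apply: cauchy_exP => e e0; have x1 : 0 < `|x| + 1 by rewrite ltr_wpDl.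
  have [S FS] := Fc _ (divr_gt0 e0 x1); exists (S x).
  rewrite -[_ (ball _ _)]/(F ((fun T : opSp A B => T x) @^-1` ball (S x) e)).
  apply: filterS FS => T; rewrite /preimage /= -!ball_normE /= => ST.
  have -> : S x - T x = (S - T : opSp A B) x by [].
  rewrite (le_lt_trans (opn_le _ (opfun_Lop _)))// -norm_opSpE.
  rewrite (@le_lt_trans _ _ (`|S - T| * (`|x| + 1)))//; last by rewrite -ltr_pdivlMr.
  by rewrite ler_wpM2l// lerDl.
pose L x : B := lim ((fun T : opSp A B => T x) @ F).
have FL x : (fun T : opSp A B => T x) @ F --> L x by exact: cauchy_cvg.
(* An element [T] of the ball with [T x] close to [L x] links [L x] to [S x]; the centre [S] does
   not depend on [x], which makes the estimate uniform. *)
have near_L e : 0 < e ->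
    exists2 S : opSp A B, F (ball S e) & forall x, `|L x - S x| <= e * `|x|.
  move=> e0; have [S FS] := Fc _ e0; exists S => // x.
  apply/ler_addgt0Pr => e' e'0.
  have /cvgrPdist_le/(_ _ e'0) FLx := FL x.
  have [T [LT]] := filter_ex (filterI FLx FS); rewrite -ball_normE /= => ST.
  rewrite -(subrK (T x) (L x)) -addrA addrC (le_trans (ler_normD _ _))// lerD//.
  have -> : T x - S x = - (S - T : opSp A B) x by rewrite /= opprB.
  rewrite normrN (le_trans (opn_le _ (opfun_Lop _)))// ler_wpM2r//.
  by rewrite -norm_opSpE ltW.
have linL : is_lin L.
  move=> a x y; apply: cvg_lim => //.
  have -> : (fun T : opSp A B => T (a *: x + y)) =
      (fun T : opSp A B => a *: T x + T y).
    by apply/funext => T; exact: (opfun_Lop T).1.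
  apply: cvgD; last exact: FL.
  by apply: cvgZr; exact: FL.
have LopL : Lop A B L.
  have [S _ LS] := near_L _ ltr01.
  apply: (@LopP _ _ _ _ (1 + opn S)) => // x.
  rewrite -(subrK (S x) (L x)) (le_trans (ler_normD _ _))// mulrDl lerD//.
  exact/opn_le/opfun_Lop.
pose Lo : opSp A B := mk_op LopL.
apply/cvg_ex; exists Lo; apply/cvgrPdist_le => e e0.
have [S FS LS] := near_L _ (divr_gt0 e0 (ltr0Sn R 1)).
apply: filterS FS => T; rewrite -ball_normE /= => ST.
rewrite -(subrK S Lo) -addrA (le_trans (ler_normD _ _))// [leRHS]splitr.
rewrite lerD//; last exact: ltW.
rewrite norm_opSpE; apply: opn_ubM => [|x]; first by rewrite divr_ge0// ltW.
exact: LS.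
Qed.

HB.instance Definition _ :=
  Uniform_isComplete.Build (opSp A B) opSp_complete.

End OperatorSpaceComplete.

(** * Hahn-Banach through minimal sublinear functionals *)

Section HahnBanach.
Context {R : realType} {V : lmodType R}.

Definition sublinear (p : V -> R) :=
  (forall x y, p (x + y) <= p x + p y) /\
  (forall a x, 0 <= a -> p (a *: x) = a * p x).

Lemma sublinear0 (p : V -> R) : sublinear p -> p 0 = 0.
Proof. by move=> [_ pZ]; rewrite -(scale0r 0) pZ// mul0r. Qed.

Lemma sublinear_geN (p : V -> R) x : sublinear p -> - p (- x) <= p x.
Proof.
move=> sp; rewrite -subr_ge0 opprK -(sublinear0 sp) -(subrr x).
exact: sp.1.
Qed.

(* A minimal sublinear functional is linear because [tilt] cannot decrease it;
   tilting the norm along [y] first forces the linear minorant to norm [y]. *)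
Definition tilt (p : V -> R) x0 x : R :=
  inf [set p (x + t *: x0) - t * p x0 | t in [set t : R | 0 <= t]].

Section Tilt.
Variables (p : V -> R) (x0 : V).
Hypothesis sp : sublinear p.

Let tilt_set_neq0 x :
  [set p (x + t *: x0) - t * p x0 | t in [set t : R | 0 <= t]] !=set0.
Proof. by eexists; exists 0 => /=. Qed.

Let tilt_lb x :
  lbound [set p (x + t *: x0) - t * p x0 | t in [set t : R | 0 <= t]] (- p (- x)).
Proof.
move=> _ [t /= t0 <-]; rewrite lerBrDr -sp.2// addrC lerBlDr.
by rewrite (le_trans _ (sp.1 _ _))// addrAC subrr add0r.
Qed.

Lemma tilt_le t x : 0 <= t -> tilt p x0 x <= p (x + t *: x0) - t * p x0.
Proof. by move=> t0; apply: ge_inf; [exists (- p (- x)) | exists t]. Qed.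

Lemma tilt_le_self x : tilt p x0 x <= p x.
Proof. by have := tilt_le x (lexx 0); rewrite scale0r addr0 mul0r subr0. Qed.

Lemma tilt_ge x (M : R) :
  (forall t, 0 <= t -> M <= p (x + t *: x0) - t * p x0) -> M <= tilt p x0 x.
Proof. by move=> ge; apply: lb_le_inf => // _ [t /= t0 <-]; exact: ge. Qed.

Lemma tilt_sublinear : sublinear (tilt p x0).
Proof.
have le a x : 0 < a -> tilt p x0 (a *: x) <= a * tilt p x0 x.
  move=> a0; rewrite -ler_pdivrMl//; apply: tilt_ge => t t0.
  rewrite ler_pdivrMl// mulrBr -(sp.2 a) ?(ltW a0)// scalerDr scalerA mulrA.
  by apply: tilt_le; rewrite mulr_ge0// ltW.
split=> [x y|a x].
  rewrite -lerBlDr; apply: tilt_ge => s s0; rewrite lerBlDl -lerBlDr.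
  apply: tilt_ge => t t0; rewrite lerBlDr (le_trans (tilt_le _ (addr_ge0 s0 t0)))//.
  rewrite scalerDl addrACA.
  by have := sp.1 (x + s *: x0) (y + t *: x0); lra.
rewrite le_eqVlt => /predU1P[<-|a0].
  rewrite scale0r mul0r; apply/le_anti/andP; split.
    by rewrite -[leRHS](sublinear0 sp) tilt_le_self.
  apply: tilt_ge => t t0; by rewrite add0r sp.2// subrr.
apply/le_anti; rewrite le//= -ler_pdivlMl//.
have := le a^-1 (a *: x); rewrite invr_gt0 => /(_ a0).
by rewrite scalerA mulVf ?gt_eqF// scale1r.
Qed.

End Tilt.

Lemma minimal_sublinear_linear (q : V -> R) : sublinear q ->
  (forall p, sublinear p -> (forall x, p x <= q x) -> p = q) -> is_lin q.
Proof.
move=> sq minq.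
have add x y : q (x + y) = q x + q y.
  apply/le_anti; rewrite sq.1/= -lerBrDr.
  (* By minimality, the term [t = 1] of the infimum gives [q x <= q (x + y) - q y], the reverse of
     subadditivity. *)
  have tq : tilt q y = q.
    apply: minq; [exact: tilt_sublinear | exact: tilt_le_self].
  by have := tilt_le y sq x ler01; rewrite tq scale1r mul1r.
move=> a x y; rewrite add; congr (_ + _).
have [a0|a0] := leP 0 a; first exact: sq.2.
have qN z : q (- z) = - q z.
  by apply/eqP; rewrite -addr_eq0 -add addNr sublinear0.
rewrite -[a]opprK scaleNr qN sq.2 ?oppr_ge0 ?(ltW a0)//.
by rewrite [RHS]mulNr.
Qed.

(** Zorn's lemma yields a minimal sublinear functional below [p], which is linear. The relation [r]
    is the reversed pointwise order, and a nonempty chain is bounded by its pointwise infimum. *)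
Lemma hahn_banach (p : V -> R) : sublinear p ->
  exists2 f : V -> R, is_lin f & forall x, f x <= p x.
Proof.
move=> sp.
pose T := {q : V -> R | sublinear q /\ forall x, q x <= p x}.
pose r : rel T := fun q q' => `[< forall x, sval q' x <= sval q x >].
have [| | |C totC|[q [sq qp]] qmin] := @Zorn T r.
- by move=> q; apply/asboolP.
- move=> q1 q2 q3 /asboolP h1 /asboolP h2; apply/asboolP => x.
  exact: le_trans (h2 x) (h1 x).
- move=> [q1 h1] [q2 h2] /asboolP/= h12 /asboolP/= h21; apply: eq_exist => /=.
  by apply/funext => x; apply/le_anti; rewrite h12 h21.
(* The empty chain is bounded by [p] itself. *)
- have [[q0 Cq0]|C0] := pselect (C !=set0); last first.
    exists (exist _ p (conj sp (fun x => lexx _))) => q Cq.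
    by exfalso; apply: C0; exists q.
  pose S x := [set sval q x | q in C].
  have Sne x : S x !=set0 by exists (sval q0 x); exists q0.
  have Slb x : lbound (S x) (- p (- x)).
    move=> _ [[q [sq qp]] Cq <-] /=; rewrite (le_trans _ (sublinear_geN x sq))//.
    by rewrite lerN2.
  pose g x := inf (S x).
  have g_le q x : C q -> g x <= sval q x.
    by move=> Cq; apply: ge_inf; [exists (- p (- x)); exact: Slb | exists q].
  have g_ge x M : (forall q, C q -> M <= sval q x) -> M <= g x.
    by move=> ge; apply: lb_le_inf => // _ [q Cq <-]; exact: ge.
  have sg : sublinear g.
    split=> [x y|a x a0].
      rewrite -lerBlDr; apply: (g_ge) => q1 C1; rewrite lerBlDl -lerBlDr.
      apply: (g_ge) => q2 C2; rewrite lerBlDr.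
      (* The smaller of the two members bounds both terms, so its own subadditivity suffices. *)
      have [/asboolP le12|/asboolP le21] := totC _ _ C1 C2.
        rewrite (le_trans (g_le _ _ C2))// (le_trans ((svalP q2).1.1 _ _))//.
        by rewrite addrC lerD2l.
      rewrite (le_trans (g_le _ _ C1))// (le_trans ((svalP q1).1.1 _ _))//.
      by rewrite addrC lerD2r.
    move: a0; rewrite le_eqVlt => /predU1P[<-|a0].
      rewrite scale0r mul0r; apply/le_anti/andP; split.
        by rewrite (le_trans (g_le _ _ Cq0))// (sublinear0 (svalP q0).1).
      by apply: (g_ge) => q _; rewrite (sublinear0 (svalP q).1).
    apply/le_anti/andP; split.
      rewrite -ler_pdivrMl//; apply: (g_ge) => q Cq; rewrite ler_pdivrMl//.
      by rewrite -(svalP q).1.2 ?(ltW a0)// g_le.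
    apply: (g_ge) => q Cq; rewrite (svalP q).1.2 ?(ltW a0)//.
    by rewrite ler_wpM2l ?(ltW a0)// g_le.
  have gp x : g x <= p x by rewrite (le_trans (g_le _ _ Cq0))// (svalP q0).2.
  exists (exist _ g (conj sg gp)) => q Cq; apply/asboolP => x /=; exact: g_le.
exists q => //; apply: minimal_sublinear_linear => // q' sq' q'q.
have q'p x : q' x <= p x by rewrite (le_trans (q'q x)).
suff /qmin/(congr1 sval) :
  r (exist _ q (conj sq qp)) (exist _ q' (conj sq' q'p)) by [].
exact/asboolP.
Qed.

End HahnBanach.

Lemma norming_functional (R : realType) (Y : normedModType R) (y : Y) :
  exists f : opSp Y R, (forall x, `|f x| <= `|x|) /\ f y = `|y|.
Proof.
pose p (x : Y) := `|x|.
have sp : sublinear p.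
  by split=> [a b|a x a0]; [exact: ler_normD | rewrite /p normrZ ger0_norm].
have [f linf fle] := hahn_banach (tilt_sublinear y sp).
have fp x : f x <= `|x| by rewrite (le_trans (fle x))// tilt_le_self.
have f_norm x : `|f x| <= `|x|.
  by rewrite ler_norml fp lerNl -(is_linN linf) -(normrN x) fp.
have Lf : Lop Y R f.
  by apply: (@LopP _ _ _ _ 1) => // x; rewrite mul1r.
exists (mk_op Lf); split => //=.
apply/le_anti; rewrite fp/=.
(* At [- y], the term [t = 1] of the tilt is [|0| - |y|], so [f (- y) <= - |y|]. *)
have := le_trans (fle (- y)) (tilt_le y sp (- y) ler01).
by rewrite scale1r mul1r addNr /p normr0 sub0r (is_linN linf) lerN2.
Qed.

(** * Octahedrality: normalisation and transposition *)

Section Octahedral.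
Context {R : realType}.

(** A [T] in the unit ball almost at distance 2 has norm at least [1 - e], so normalising it costs
    at most a further [e], and [2 * e <= eps]. The bound [e <= 1/2] keeps [T] nonzero, and the sign
    of the witness turns sums into differences. *)
Lemma octahedral_ball (A B : normedModType R) (H : set (A -> B)) :
  lsubspace H -> H `<=` Lop A B ->
  (forall (n : nat) (S : 'I_n.+1 -> A -> B) (eps : R), 0 < eps ->
    (forall i, H (S i) /\ opn (S i) = 1) ->
    exists2 T, H T & opn T <= 1 /\ forall i, 2 - eps <= opn (S i + T)) ->
  octahedral (@opn R A B) H.
Proof.
move=> [H0 HZD] HL ball n S eps eps0 S1.
pose e := Num.min (eps / 2) 2^-1.
have e0 : 0 < e by rewrite lt_min divr_gt0//= invr_gt0.
have [T HT [T1 ST]] := ball n S e e0 S1.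
have LT := HL _ HT; have LS i := HL _ (S1 i).1.
have Te : 1 - e <= opn T.
  have := le_trans (ST ord0) (opnD (LS ord0) LT).
  by rewrite (S1 ord0).2; lra.
have e2 : e <= eps / 2 by rewrite ge_min lexx.
have e3 : e <= 2^-1 by rewrite ge_min lexx orbT.
have T0 : 0 < opn T by lra.
have HZ a U : H U -> H (a *: U) by move=> HU; rewrite -[_ *: _]addr0; exact: HZD.
exists (- (opn T)^-1 *: T); split; first exact: HZ.
have normT : opn (- (opn T)^-1 *: T) = 1.
  by rewrite opnZ// normrN gtr0_norm ?invr_gt0// mulVf// gt_eqF.
split=> // i.
have dec : S i + T = (S i - (- (opn T)^-1 *: T)) + (1 - (opn T)^-1) *: T.
  by rewrite scaleNr opprK scalerBl scale1r addrA addrAC addrK.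
have := ST i; rewrite dec => /le_trans/(_ (opnD _ _)).
rewrite opnZ//.
have -> : `|1 - (opn T)^-1| * opn T = 1 - opn T.
  rewrite -[X in _ * X](gtr0_norm T0) -normrM mulrBl mul1r mulVf ?gt_eqF//.
  by rewrite distrC ger0_norm// subr_ge0.
have LB := LopB (LS i) (LopZ (- (opn T)^-1) LT).
by move=> /(_ LB (LopZ _ LT)); lra.
Qed.

Lemma Lop_lsubspace (A B : normedModType R) : lsubspace (Lop A B).
Proof. by split; [exact: Lop0 | exact: LopZD]. Qed.

Section Flip.
Variables A B : normedModType R.

(** Transposition, kept as a relation: by symmetry, one norm inequality then gives both. *)
Definition flips (S : A -> opSp B R) (T : B -> opSp A R) :=
  forall a b, S a b = T b a.

Lemma flips_opn_le S T : flips S T -> Lop A (opSp B R) S -> opn T <= opn S.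
Proof.
move=> ST LS; apply: opn_ub => b b1.
rewrite norm_opSpE; apply: opn_ub => a a1; rewrite -ST.
rewrite (le_trans (opn_le1 (opfun_Lop _) b1))// -norm_opSpE.
exact: opn_le1.
Qed.

Lemma flip_ex (S : A -> opSp B R) : Lop A (opSp B R) S ->
  exists2 T : B -> opSp A R, Lop B (opSp A R) T & flips S T.
Proof.
move=> LS; have LSb b : Lop A R (fun a => S a b).
  apply: (@LopP _ _ _ _ (opn S * `|b|)) => [c x y|x]; first by rewrite LS.1.
  rewrite (le_trans (opn_le _ (opfun_Lop _)))// mulrAC ler_wpM2r// -norm_opSpE.
  exact: opn_le.
exists (fun b => mk_op (LSb b)) => //.
apply: (@LopP _ _ _ _ (opn S)) => [c x y|x].
  by apply/val_inj/funext => a; exact: (opfun_Lop (S a)).1.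
rewrite norm_opSpE; apply: opn_ubM => [|a].
  by rewrite mulr_ge0// opn_ge0.
rewrite (le_trans (opn_le x (opfun_Lop (S a))))// mulrAC ler_wpM2r// -norm_opSpE.
exact: opn_le.
Qed.

End Flip.

Lemma flips_sym (A B : normedModType R) S T : @flips A B S T -> @flips B A T S.
Proof. by move=> ST b a. Qed.

Lemma flips_opn (A B : normedModType R) S T : @flips A B S T ->
  Lop A (opSp B R) S -> Lop B (opSp A R) T -> opn S = opn T.
Proof.
move=> ST LS LT; apply/le_anti; rewrite (flips_opn_le ST LS) andbT.
exact: flips_opn_le (flips_sym ST) LT.
Qed.

(** Transposition maps [Lop A (opSp B R)] isometrically onto [Lop B (opSp A R)] and respects
    differences, so a far point found for the transposes can be transposed back. *)
Lemma octahedral_flip (A B : normedModType R) :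
  octahedral (@opn R A (opSp B R)) (Lop A (opSp B R)) ->
  octahedral (@opn R B (opSp A R)) (Lop B (opSp A R)).
Proof.
move=> oct n S eps eps0 S1.
have /choice[S' S'P] i : exists S', Lop A (opSp B R) S' /\ flips (S i) S'.
  by have [T LT fT] := flip_ex (S1 i).1; exists T.
have [|T [LT [T1 ST]]] := oct n S' eps eps0.
  move=> i; split; first exact: (S'P i).1.
  by rewrite -(flips_opn (S'P i).2 (S1 i).1 (S'P i).1) (S1 i).2.
have [T' LT' fT] := flip_ex LT.
exists T'; split=> //; split; first by rewrite -(flips_opn fT).
move=> i; rewrite (@flips_opn _ _ (S i - T') (S' i - T)) ?ST//.
- move=> b a; change (S i b a - T' b a = S' i a b - T a b).
  by rewrite (S'P i).2 fT.
- exact: LopB (S1 i).1 LT'.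
- exact: LopB (S'P i).1 LT.
Qed.

Section DualValued.
Variables Y X : normedModType R.

Lemma Lop_dualP (S : Y -> opSp X R) :
  Lop_dual Y X (fun y => S y : X -> R) <-> Lop Y (opSp X R) S.
Proof.
split=> [[_ [linS [M SM]]]|[linS [M SM]]].
  by split; [move=> a x y; apply/val_inj/linS | exists M].
split; first by move=> y; exact: opfun_Lop.
by split; [move=> a x y; rewrite linS | exists M].
Qed.

Lemma Lop_dual_ex (S : Y -> (X -> R)) : Lop_dual Y X S ->
  exists2 S' : Y -> opSp X R, Lop Y (opSp X R) S' & S = fun y => S' y.
Proof.
move=> LS; pose S' y := mk_op (LS.1 y).
by exists S' => //; apply/Lop_dualP.
Qed.

(** Bridge between the bare functionals of the main statement and the bundled dual, to which the
    results on normed modules apply. *)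
Lemma octahedral_dual :
  octahedral (@opn_dual R Y X) (Lop_dual Y X) <->
  octahedral (@opn R Y (opSp X R)) (Lop Y (opSp X R)).
Proof.
split=> oct n S eps eps0 S1.
  have [|T [LT [T1 ST]]] := oct n (fun i y => S i y) eps eps0.
    by move=> i; split; [exact/Lop_dualP/(S1 i).1 | exact: (S1 i).2].
  have [T' LT' TE] := Lop_dual_ex LT; exists T'.
  by move: T1 ST; rewrite TE.
have /choice[S' S'P] i : exists S' : Y -> opSp X R,
    Lop Y (opSp X R) S' /\ S i = fun y => S' y.
  by have [S' ? ?] := Lop_dual_ex (S1 i).1; exists S'.
have [|T [LT [T1 ST]]] := oct n S' eps eps0.
  move=> i; split; first exact: (S'P i).1.
  by have := (S1 i).2; rewrite (S'P i).2.
exists (fun y => T y : X -> R); split; first exact/Lop_dualP.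
by split=> // i; rewrite (S'P i).2; exact: ST.
Qed.

End DualValued.
End Octahedral.

(** * A renorming of the max norm with exposed unit vectors *)

(* The argument [d] only keys the norm instance. *)
Definition round_space (R : realType) (n : nat) (d : {posnum R}) : Type :=
  'rV[R]_n.+1.

Section RoundNorm.
Context {R : realType} (n : nat) (d : {posnum R}).
Implicit Types x y : 'rV[R]_n.+1.

Definition sqnorm2 x : R := \sum_(i < n.+1) x ord0 i ^+ 2.

Lemma sqnorm2_ge0 x : 0 <= sqnorm2 x.
Proof. by apply: sumr_ge0 => i _; exact: sqr_ge0. Qed.

Definition sqround x : R := `|x| ^+ 2 + d%:num * sqnorm2 x.

Lemma coord_le_norm x i : `|x ord0 i| <= `|x|.
Proof.
rewrite [leRHS]/Num.norm /= mx_normrE.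
by apply: (le_bigmax _ (fun ij => `|x ij.1 ij.2|) (ord0, i)).
Qed.

Lemma norm_coord_ex x : exists i, `|x| = `|x ord0 i|.
Proof.
have [x0|x0] := eqVneq `|x| 0.
  exists ord0; apply/le_anti.
  by rewrite coord_le_norm x0 normr_ge0.
have [[i j]] := mx_norm_neq0 x0 => /= xE.
by exists j; rewrite [LHS]xE (ord1 i).
Qed.

Definition argnorm x : 'I_n.+1 := projT1 (cid (norm_coord_ex x)).

Lemma argnormP x : `|x| = `|x ord0 (argnorm x)|.
Proof. exact: projT2 (cid (norm_coord_ex x)). Qed.

(* A subgradient at [y] of half the squared norm. *)
Definition support_form y x : R :=
  y ord0 (argnorm y) * x ord0 (argnorm y)
  + d%:num * \sum_(i < n.+1) y ord0 i * x ord0 i.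

Lemma support_formP y : is_lin (support_form y).
Proof.
move=> a x1 x2; rewrite /support_form !mxE.
have -> : \sum_(i < n.+1) y ord0 i * (a *: x1 + x2) ord0 i =
    a * (\sum_(i < n.+1) y ord0 i * x1 ord0 i) + \sum_(i < n.+1) y ord0 i * x2 ord0 i.
  rewrite mulr_sumr -big_split /=; apply: eq_bigr => i _; rewrite !mxE; ring.
rewrite /GRing.scale /=; ring.
Qed.

Lemma support_form_self y : support_form y y = sqround y.
Proof.
by rewrite /support_form /sqround argnormP real_normK ?num_real// -expr2.
Qed.

(** The Euclidean parts contribute exactly the left side. With [j = argnorm y], what remains is
    [|x|^2 + |y|^2 - 2 * y_j * x_j], at least [(x_j - y_j)^2] since [|y| = |y_j|] and
    [|x| >= |x_j|]. *)
Lemma support_form_gap y x :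
  d%:num * sqnorm2 (x - y) <= sqround x + sqround y - 2 * support_form y x.
Proof.
have sqB : sqnorm2 (x - y) =
    sqnorm2 x + sqnorm2 y - 2 * \sum_(i < n.+1) y ord0 i * x ord0 i.
  rewrite mulr_sumr -sumrN -!big_split /=.
  by apply: eq_bigr => i _; rewrite !mxE; ring.
have : (x ord0 (argnorm y)) ^+ 2 <= `|x| ^+ 2.
  by rewrite -real_normK ?num_real// lerXn2r ?nnegrE// coord_le_norm.
rewrite sqB /sqround /support_form (argnormP y) [`|y _ _| ^+ 2]real_normK ?num_real//.
have := sqr_ge0 (x ord0 (argnorm y) - y ord0 (argnorm y)); nra.
Qed.

Lemma sqround_ge0 x : 0 <= sqround x.
Proof. by rewrite addr_ge0 ?sqr_ge0// mulr_ge0// sqnorm2_ge0. Qed.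

Lemma sqround_scale a x : sqround (a *: x) = a ^+ 2 * sqround x.
Proof.
rewrite /sqround normrZ exprMn real_normK ?num_real// mulrDr; congr (_ + _).
rewrite mulrCA /sqnorm2 [in RHS]mulr_sumr; congr (_ * _).
by apply: eq_bigr => i _; rewrite mxE exprMn.
Qed.

Definition round_norm x : R := Num.sqrt (sqround x).

Lemma round_norm_ge0 x : 0 <= round_norm x.
Proof. exact: sqrtr_ge0. Qed.

Lemma round_norm_sqr x : round_norm x ^+ 2 = sqround x.
Proof. by rewrite sqr_sqrtr// sqround_ge0. Qed.

Lemma round_normZ a x : round_norm (a *: x) = `|a| * round_norm x.
Proof. by rewrite /round_norm sqround_scale sqrtrM ?sqr_ge0// sqrtr_sqr. Qed.

Lemma norm_le_round x : `|x| <= round_norm x.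
Proof.
rewrite -(ger0_norm (normr_ge0 x)) -sqrtr_sqr ler_wsqrtr//.
by rewrite lerDl mulr_ge0// sqnorm2_ge0.
Qed.

Lemma round_norm_eq0 x : round_norm x = 0 -> x = 0.
Proof.
move=> x0; apply/normr0_eq0/le_anti; rewrite normr_ge0 andbT.
by rewrite -x0 norm_le_round.
Qed.

(** A Cauchy-Schwarz inequality: for [x] nonzero, the gap estimate is applied to the multiple of [x]
    that has the round norm of [y]. *)
Lemma support_form_le y x : support_form y x <= round_norm y * round_norm x.
Proof.
have [/round_norm_eq0 ->|x0] := eqVneq (round_norm x) 0.
  by rewrite (is_lin0 (support_formP y)) mulr_ge0 ?round_norm_ge0.
have xpos : 0 < round_norm x by rewrite lt_neqAle eq_sym x0 round_norm_ge0.
set a := round_norm x in xpos *; set b := round_norm y.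
have := support_form_gap y ((b / a) *: x).
rewrite (is_linZ (support_formP y)) sqround_scale -!round_norm_sqr -/a -/b.
have -> : (b / a) ^+ 2 * a ^+ 2 = b ^+ 2 by field; exact: lt0r_neq0.
have := mulr_ge0 (ltW [gt0 of d%:num]) (sqnorm2_ge0 (b / a *: x - y)).
rewrite /GRing.scale /=.
move=> /le_trans h /h{h} ineq.
have [b0|b0] := eqVneq b 0.
  have -> : y = 0 by apply: round_norm_eq0.
  have -> : support_form 0 x = 0.
    rewrite /support_form mxE mul0r add0r big1 ?mulr0// => i _.
    by rewrite mxE mul0r.
  by rewrite mulr_ge0 ?round_norm_ge0// ltW.
have bpos : 0 < b by rewrite lt_neqAle eq_sym b0 round_norm_ge0.
have : b / a * support_form y x <= b ^+ 2 by lra.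
by rewrite expr2 mulrAC -mulrA ler_pM2l// ler_pdivrMr.
Qed.

Lemma round_normD x y : round_norm (x + y) <= round_norm x + round_norm y.
Proof.
have [->|s0] := eqVneq (round_norm (x + y)) 0.
  by rewrite addr_ge0 ?round_norm_ge0.
have spos : 0 < round_norm (x + y) by rewrite lt_neqAle eq_sym s0 round_norm_ge0.
(* The squared norm of [w = x + y] is [support_form w w], which splits linearly into two terms
   bounded by [support_form_le]. *)
rewrite -(ler_pM2l spos) -expr2 round_norm_sqr -support_form_self.
by rewrite (is_linD (support_formP _)) mulrDr lerD// support_form_le.
Qed.

Lemma sqnorm2_le x : sqnorm2 x <= n.+1%:R * `|x| ^+ 2.
Proof.
have -> : n.+1%:R * `|x| ^+ 2 = \sum_(i < n.+1) `|x| ^+ 2.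
  by rewrite sumr_const card_ord mulr_natl.
apply: ler_sum => i _.
by rewrite -real_normK ?num_real// lerXn2r ?nnegrE// coord_le_norm.
Qed.

Lemma round_le_norm x : round_norm x <= (1 + d%:num * n.+1%:R) * `|x|.
Proof.
have K0 : 0 <= d%:num * n.+1%:R :> R by rewrite mulr_ge0.
rewrite -[leRHS]ger0_norm ?mulr_ge0 ?addr_ge0// -sqrtr_sqr ler_wsqrtr//.
rewrite /sqround exprMn.
have := ler_wpM2l (ltW [gt0 of d%:num]) (sqnorm2_le x).
rewrite mulrA; set k := d%:num * _ in K0 *.
have := mulr_ge0 K0 (sqr_ge0 `|x|).
by have := mulr_ge0 (sqr_ge0 k) (sqr_ge0 `|x|); lra.
Qed.

HB.instance Definition _ := GRing.Lmodule.on (round_space n d).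
HB.instance Definition _ := @Lmodule_isNormed.Build R (round_space n d)
  round_norm round_normD round_normZ round_norm_eq0.

(** Assertion (3) concerns complete [Y] only. Equivalence with the max norm transfers the
    completeness of row vectors. *)
Lemma round_space_complete (F : set_system (round_space n d)) :
  ProperFilter F -> cauchy F -> cvg F.
Proof.
move=> FF /cauchyP Fc; set K : R := 1 + d%:num * n.+1%:R.
have K0 : 0 < K by rewrite ltr_pwDl// mulr_ge0.
have : @cauchy 'rV[R]_n.+1 F.
  apply: cauchy_exP => e e0; have [x Fx] := Fc e e0; exists x.
  apply: filterS Fx => y; rewrite -!ball_normE /=.
  exact/le_lt_trans/norm_le_round.
move=> /cauchy_cvg/cvgrPdist_lt Fl.
apply/cvg_ex; exists (lim (F : set_system 'rV[R]_n.+1)).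
apply/cvgrPdist_lt => e e0.
have := Fl _ (divr_gt0 e0 K0); apply: filterS => y.
rewrite ltr_pdivlMr// mulrC; exact/le_lt_trans/round_le_norm.
Qed.

HB.instance Definition _ :=
  Uniform_isComplete.Build (round_space n d) round_space_complete.

End RoundNorm.

(** * Norms on row vectors, finite nets and free families *)

Section FiniteDimension.
Context {R : realType}.

Section RowNorm.
Variables (k : nat) (N : 'rV[R]_k.+1 -> R).
Hypothesis ND : forall x y, N (x + y) <= N x + N y.
Hypothesis NZ : forall a x, N (a *: x) = `|a| * N x.

Let N0 : N 0 = 0. Proof. by rewrite -(scale0r 0) NZ normr0 mul0r. Qed.

Let NN x : N (- x) = N x.
Proof. by rewrite -scaleN1r NZ normrN normr1 mul1r. Qed.

Let N_ge0 x : 0 <= N x.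
Proof. by have := ND x (- x); rewrite subrr N0 NN -mulr2n pmulrn_lge0. Qed.

Let N_le_norm : exists2 M, 0 < M & forall x, N x <= M * `|x|.
Proof.
exists (1 + \sum_(i < k.+1) N (delta_mx ord0 i)).
  by rewrite ltr_pwDl// sumr_ge0.
move=> x; rewrite mulrDl mul1r.
apply: (@le_trans _ _ ((\sum_(i < k.+1) N (delta_mx ord0 i)) * `|x|)); last first.
  by rewrite lerDr.
rewrite [in leLHS](row_sum_delta x) mulr_suml.
elim/big_ind2 : _ => [|x1 x2 y1 y2 h1 h2|i _]; first by rewrite N0.
  by rewrite (le_trans (ND _ _))// lerD.
rewrite NZ mulrC ler_wpM2l// [leRHS]/Num.norm /= mx_normrE.
exact: (le_bigmax _ (fun ij => `|x ij.1 ij.2|) (ord0, i)).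
Qed.

Let N_continuous : continuous N.
Proof.
have [M M0 NM] := N_le_norm.
move=> x; apply/(@cvgrPdist_le _ _ _ (nbhs x) (nbhs_filter x)) => e e0.
apply/nbhs_ballP; exists (e / M) => [|y /=]; first exact: divr_gt0.
rewrite -ball_normE /= ltr_pdivlMr// mulrC => /ltW/(le_trans (NM _)).
have h1 : N x <= N (x - y) + N y by rewrite -{1}(subrK y x) ND.
have h2 : N y <= N (x - y) + N x.
  by rewrite -[N (x - y)]NN opprB -{1}(subrK x y) ND.
by apply: le_trans; rewrite ler_norml; apply/andP; split; lra.
Qed.

Hypothesis N_eq0 : forall x, N x = 0 -> x = 0.

(** [N] is continuous and positive on the compact unit sphere of the max norm, so its minimum there
    serves as [m]. *)
Let norm_le_N : exists2 m, 0 < m & forall x, m * `|x| <= N x.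
Proof.
pose S := [set x : 'rV[R]_k.+1 | `|x| = 1].
have cS : compact S.
  apply: bounded_closed_compact.
    by exists 1; split => // M M1 x /= ->; exact: ltW.
  rewrite -[S]/((fun x : 'rV[R]_k.+1 => `|x|) @^-1` [set z : R | z = 1]).
  apply: preimage_closed; last exact: closed_eq.
  by move=> x _; exact: norm_continuous.
have neS x : x != 0 -> S (`|x|^-1 *: x).
  move=> x0; rewrite /S /= normrZ normfV normr_id mulVf//.
  by rewrite normr_eq0.
have S0 : S !=set0.
  exists (`|const_mx 1 : 'rV[R]_k.+1|^-1 *: const_mx 1); apply: neS.
  apply/eqP => /matrixP/(_ ord0 ord0); rewrite !mxE; exact/eqP/oner_neq0.
have [|c /[!inE] Sc cmin] := compact_EVT_min (f := N) S0 cS.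
  exact/continuous_subspaceT.
have Nc : 0 < N c.
  rewrite lt_neqAle N_ge0 andbT eq_sym; apply/eqP => /N_eq0 c0.
  by move: Sc; rewrite /S /= c0 normr0 => /esym/eqP; rewrite oner_eq0.
exists (N c) => // x; have [->|x0] := eqVneq x 0; first by rewrite normr0 mulr0 N0.
have := cmin _ (mem_set (neS x x0)); rewrite NZ normfV normr_id.
by rewrite ler_pdivlMl ?normr_gt0// mulrC.
Qed.

Lemma unit_multiple x : exists2 u, N u = 1 & x = N x *: u.
Proof.
have unit y : y != 0 -> N ((N y)^-1 *: y) = 1.
  move=> y0; have Ny : N y != 0 by apply: contra_neq y0; exact: N_eq0.
  by rewrite NZ normfV ger0_norm// mulVf.
have [->|x0] := eqVneq x 0; last first.
  exists ((N x)^-1 *: x); first exact: unit.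
  rewrite scalerA divff ?scale1r//; apply: contra_neq x0; exact: N_eq0.
(* For [x = 0] any unit vector works; the row of ones is nonzero because it has [k.+1] entries. *)
exists ((N (const_mx 1))^-1 *: const_mx 1); last by rewrite N0 scale0r.
apply: unit; apply/eqP => /matrixP/(_ ord0 ord0); rewrite !mxE.
exact/eqP/oner_neq0.
Qed.

(** Compactness of the unit sphere of [N]. The norm is a plain function with hypotheses because it
    stands both for [round_norm] and for the norm pulled back along a free family. *)
Lemma unit_net (e : R) : 0 < e -> exists s : seq 'rV[R]_k.+1,
  (forall x, x \in s -> N x = 1) /\
  forall x, N x = 1 -> exists2 y, y \in s & N (x - y) <= e.
Proof.
move=> e0; have [M M0 NM] := N_le_norm; have [m m0 mN] := norm_le_N.
pose S := [set x | N x = 1].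
have : compact S.
  apply: bounded_closed_compact.
    exists m^-1; split; first exact: num_real.
    move=> r mr x /= Nx; apply: le_trans (ltW mr).
    by rewrite -[leRHS]mulr1 ler_pdivlMl// -Nx.
  rewrite -[S]/(N @^-1` [set z : R | z = 1]).
  apply: preimage_closed; last exact: closed_eq.
  by move=> x _; exact: N_continuous.
rewrite compact_cover => /(_ _ S (fun x => ball x (e / M))) [].
- by move=> x _; exact: ball_open.
- by move=> x Sx; exists x => //; exact/ballxx/divr_gt0.
move=> D DS SD; exists (finmap.enum_fset D); split=> [x xD|x Nx].
  by have := DS _ xD; rewrite inE.
have [y /= yD] := SD _ Nx; rewrite -ball_normE /= => xy.
exists y => //; rewrite (le_trans (NM _))// -normrN opprB mulrC.
by rewrite -ler_pdivlMr// ltW.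
Qed.

End RowNorm.

Definition lincomb (V : lmodType R) k (f : 'I_k -> V) (c : 'rV[R]_k) : V :=
  \sum_(i < k) c ord0 i *: f i.

Lemma lincomb_lin (V : lmodType R) k (f : 'I_k -> V) : is_lin (lincomb f).
Proof.
move=> a x y; rewrite /lincomb scaler_sumr -big_split /=.
by apply: eq_bigr => i _; rewrite !mxE scalerDl scalerA.
Qed.

(** As long as there is a nontrivial relation, a vector with nonzero coefficient in it is dropped.
    Freeness makes the norm of [lincomb g c] a norm in [c], so that nets exist. *)
Lemma free_subfamily (V : lmodType R) k (f : 'I_k -> V) :
  exists (l : nat) (g : 'I_l -> V),
    (forall c, exists c', lincomb f c = lincomb g c') /\
    (forall c, lincomb g c = 0 -> c = 0).
Proof.
elim: k f => [|k IH] f.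
  by exists 0, f; split=> [c|c _]; [exists c | exact: thinmx0].
have [?|] := pselect (forall c, lincomb f c = 0 -> c = 0).
  by exists k.+1, f; split => // c; exists c.
move=> /existsNP[b /not_implyP[fb0 /eqP b0]].
have [j bj0] : exists j, b ord0 j != 0.
  apply/existsP; apply: contraNT b0 => /existsPn bj; apply/eqP/rowP => j.
  by have := bj j; rewrite negbK mxE => /eqP.
have [l [g [fg gfree]]] := IH (fun i => f (lift j i)).
exists l, g; split => // c.
(* Subtracting [a] times the relation [b] cancels the coefficient at [j] without changing the
   combination. *)
pose a := c ord0 j / b ord0 j.
have [c' cc'] := fg (\row_i (c - a *: b) ord0 (lift j i)); exists c'.
rewrite -cc' -[LHS]subr0 -(scaler0 _ a) -fb0 -(is_linZ (lincomb_lin f)).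
rewrite -(is_linB (lincomb_lin f)) /lincomb (bigD1_ord j)//=.
rewrite !mxE divfK// subrr scale0r add0r.
by apply: eq_bigr => i _; rewrite !mxE.
Qed.

End FiniteDimension.

(** * Slices at exposed points and rank-one operators *)

Section ExposedPoints.
Context {R : realType}.

(** The gap estimate gives [d * |x - y|_2^2 <= 2 * e], and the max norm is at most the Euclidean
    one, whence the factor [1 + 1/d]. *)
Lemma support_form_exposes n (d : {posnum R}) (y x : 'rV[R]_n.+1) (e : R) :
  round_norm d y <= 1 -> round_norm d x <= 1 -> 1 - e <= support_form d y x ->
  round_norm d (x - y) ^+ 2 <= 2 * e * (1 + d%:num^-1).
Proof.
move=> y1 x1 yx; have := support_form_gap d y x.
rewrite -!round_norm_sqr.
have sq1 (z : 'rV[R]_n.+1) : round_norm d z <= 1 -> round_norm d z ^+ 2 <= 1.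
  by move=> z1; rewrite expr_le1// round_norm_ge0.
have := sq1 _ x1; have := sq1 _ y1 => yy xx gap.
have {}gap : d%:num * sqnorm2 (x - y) <= 2 * e by lra.
have q : `|x - y| ^+ 2 <= sqnorm2 (x - y).
  rewrite argnormP real_normK ?num_real// /sqnorm2 (bigD1 (argnorm (x - y)))//=.
  by rewrite lerDl sumr_ge0// => i _; exact: sqr_ge0.
have : sqnorm2 (x - y) <= 2 * e * d%:num^-1.
  by rewrite ler_pdivlMr// mulrC.
rewrite round_norm_sqr /sqround mulrDr mulr1; lra.
Qed.

(** For [b <= a], writing [a u + b w = a (u + w) - (a - b) w] gives the lower bound
    [a (2 - e) - (a - b) = a + b - e a]. *)
Lemma norm_comb_ge (V : normedModType R) (u w : V) (e a b : R) :
  `|u| <= 1 -> `|w| <= 1 -> 2 - e <= `|u + w| -> 0 <= e -> 0 <= a -> 0 <= b ->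
  (1 - e) * (a + b) <= `|a *: u + b *: w|.
Proof.
move=> + + + e0; wlog ab : u w a b / b <= a.
  move=> H u1 w1 uw a0 b0; have [ba|/ltW ab] := leP b a; first exact: H.
  by rewrite (addrC a) [a *: u + _]addrC; apply: H => //; rewrite (addrC w).
move=> u1 w1 uw a0 b0.
have -> : a *: u + b *: w = a *: (u + w) - (a - b) *: w.
  by rewrite scalerDr scalerBl opprB addrA addrAC addrK.
rewrite (le_trans _ (lerB_dist _ _))// !normrZ (ger0_norm a0).
rewrite (ger0_norm (_ : 0 <= a - b)) ?subr_ge0//.
have := ler_wpM2l a0 uw; have : (a - b) * `|w| <= a - b.
  by rewrite ler_piMr// subr_ge0.
have := mulr_ge0 e0 b0; lra.
Qed.

(** Nets are lists, possibly empty, while [octahedral] takes nonempty families; [y = 0] serves for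
    the empty list. *)
Lemma octahedral_seq (V : lmodType R) (N : V -> R) (W : set V) (s : seq V) (e : R) :
  octahedral N W -> W 0 -> N 0 <= 1 -> 0 < e ->
  (forall x, x \in s -> W x /\ N x = 1) ->
  exists2 y, W y & N y <= 1 /\ forall x, x \in s -> 2 - e <= N (x - y).
Proof.
case: s => [|x0 s] oct W0 N01 e0 sW; first by exists 0.
have [|y [Wy [Ny xy]]] := oct (size s) (fun i => nth 0 (x0 :: s) i) e e0.
  by move=> i; apply/sW/mem_nth.
exists y => //; split=> [|x xs]; first by rewrite Ny.
have ix : (index x (x0 :: s) < (size s).+1)%N by move: (xs); rewrite -index_mem.
by have := xy (Ordinal ix); rewrite /= nth_index.
Qed.

Section Slices.
Variables (V : normedModType R) (n : nat) (d : {posnum R}).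
Let Y := round_space n d.

Definition rank1 (z : V) (y : Y) (x : Y) : V := support_form d y x *: z.

Lemma rank1_Lop z y : Lop Y V (rank1 z y).
Proof.
apply: (@LopP _ _ _ _ (`|y| * `|z|)) => [a x1 x2|x].
  by rewrite /rank1 (support_formP d y) scalerDl scalerA.
rewrite /rank1 normrZ mulrAC ler_wpM2r// ler_norml support_form_le andbT.
by rewrite lerNl -(is_linN (support_formP d y)) -(normrN x) support_form_le.
Qed.

Lemma rank1_opn z y : `|z| = 1 -> `|y| = 1 -> opn (rank1 z y) = 1.
Proof.
move=> z1 y1; apply/le_anti/andP; split.
  apply: opn_ub => x x1; rewrite /rank1 normrZ z1 mulr1 ler_norml.
  have le1 (w : Y) : `|w| <= 1 -> support_form d y w <= 1.
    by move=> w1; rewrite (le_trans (support_form_le d y w))// -[round_norm d y]/`|y| y1 mul1r.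
  by rewrite le1// lerNl -(is_linN (support_formP d y)) le1// normrN.
have := opn_le1 (rank1_Lop z y) (x := y); rewrite y1 => /(_ (lexx _)).
apply: le_trans; rewrite /rank1 support_form_self -round_norm_sqr.
by rewrite -[round_norm d y]/`|y| y1 expr1n normrZ normr1 mul1r z1.
Qed.

(* [rank1 z y - T] can only almost attain its norm near [y] or [- y]. *)
Lemma rank1_dist (z : V) (y : Y) (T : Y -> V) (e r : R) :
  Lop Y V T -> opn T <= 1 -> `|z| = 1 -> `|y| = 1 -> 0 < e -> 0 <= r ->
  4 * e * (1 + d%:num^-1) <= r ^+ 2 ->
  2 - e <= opn (rank1 z y - T) -> 2 - 4 * e - r <= `|z - T y|.
Proof.
move=> LT T1 z1 y1 e0 r0 er Te.
have [x0 x01 xT0] : exists2 x : Y, `|x| <= 1 & 2 - 2 * e < `|rank1 z y x - T x|.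
  by apply: opn_gt; apply: lt_le_trans Te; lra.
have linf := support_formP d y.
(* Changing the sign of [x] if necessary selects the slice around [y] rather than [- y]. *)
have [x [x1 fx0 xT]] : exists x : Y, [/\ `|x| <= 1, 0 <= support_form d y x &
    2 - 2 * e < `|rank1 z y x - T x|].
  have [f0|f0] := leP 0 (support_form d y x0); first by exists x0.
  exists (- x0); split; first by rewrite normrN.
    by rewrite (is_linN linf) oppr_ge0 ltW.
  by rewrite (is_linN (rank1_Lop z y).1) (is_linN LT.1) -opprD normrN.
have Tx : `|T x| <= 1 by rewrite (le_trans (opn_le1 LT x1)).
have fx1 : support_form d y x <= 1.
  rewrite (le_trans (support_form_le d y x))// -[round_norm d y]/`|y| y1 mul1r.
  exact: x1.
(* [T x] contributes at most 1 to a norm above [2 - 2 * e]. *)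
have fxe : 1 - 2 * e <= support_form d y x.
  have := lt_le_trans xT (ler_normB _ _).
  by rewrite /rank1 normrZ z1 mulr1 ger0_norm//; lra.
have y1' : round_norm d y <= 1 by rewrite -[round_norm d y]/`|y| y1.
have xy : `|x - y| <= r.
  rewrite -(@ler_pXn2r _ 2)// ?nnegrE//.
  by rewrite (le_trans (support_form_exposes y1' x1 fxe))//; lra.
have dec : rank1 z y x - T x = (z - T y) - (1 - support_form d y x) *: z - T (x - y).
  rewrite (is_linB LT.1) scalerBl scale1r /rank1 !opprB.
  by rewrite (addrC (z - T y)) !subrKA.
have : `|rank1 z y x - T x| <= `|z - T y| + (1 - support_form d y x) + r.
  rewrite dec (le_trans (ler_normB _ _))// lerD//.
    rewrite (le_trans (ler_normB _ _))// lerD// normrZ z1 mulr1 ger0_norm//.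
    by rewrite subr_ge0.
  rewrite (le_trans (opn_le _ LT))// (le_trans _ xy)//.
  by rewrite ler_piMl.
lra.
Qed.

End Slices.
End ExposedPoints.

(** * Almost l1-sums with l_oo^n, and the cycle of implications *)

Section Absorption.
Context {R : realType}.

Lemma round_operator (V : normedModType R) k (g : 'I_k.+1 -> V) n
    (d : {posnum R}) (e : R) :
  octahedral (@opn R (round_space n d) V) (Lop (round_space n d) V) ->
  (forall c, lincomb g c = 0 -> c = 0) -> 0 < e ->
  exists2 T : round_space n d -> V, Lop _ V T & opn T <= 1 /\
    forall c (y : round_space n d),
      (1 - e) * (`|lincomb g c| + `|y|) <= `|lincomb g c - T y|.
Proof.
set Y := round_space n d => oct gfree e0.
(* Error budget: [rank1_dist] loses [4 * h + r <= 2 * r], and passing from the nets to [c] and [y]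
   loses [r] each, [4 * r = e] in all. The second bound on [h] is the slice condition of
   [rank1_dist]. *)
pose r := e / 4; have r0 : 0 < r by rewrite divr_gt0.
have er : e = 4 * r by rewrite /r; lra.
pose D : R := 1 + d%:num^-1; have D0 : 0 < D by rewrite addr_gt0.
pose h := Num.min (r / 4) (r ^+ 2 / (4 * D)).
have h0 : 0 < h by rewrite lt_min !divr_gt0 ?mulr_gt0// exprn_gt0.
have hr : h <= r / 4 by rewrite ge_min lexx.
have hD : 4 * h * D <= r ^+ 2.
  by rewrite mulrAC mulrC -ler_pdivlMr ?mulr_gt0// ge_min lexx orbT.
have linT := lincomb_lin g.
pose N c := `|lincomb g c|.
have ND x y : N (x + y) <= N x + N y by rewrite /N (is_linD linT) ler_normD.
have NZ a x : N (a *: x) = `|a| * N x by rewrite /N (is_linZ linT) normrZ.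
have N_eq0 x : N x = 0 -> x = 0 by move=> /normr0_eq0/gfree.
have [sZ [sZ1 netZ]] := unit_net ND NZ N_eq0 r0.
have [sY [sY1 netY]] := unit_net (@round_normD R n d) (@round_normZ R n d)
  (@round_norm_eq0 R n d) r0.
pose s := [seq @rank1 R V n d (lincomb g c) y | c <- sZ, y <- sY].
have [||S Ss|T LT [T1 sT]] := @octahedral_seq _ _ _ _ s h oct _ _ h0.
- exact: Lop0.
- by apply: opn_ub => y y1; change (`|0 : V| <= 1); rewrite normr0.
- have /allpairsP[[c y] /= [cZ yY ->]] := Ss.
  by split; [exact: rank1_Lop | exact: rank1_opn (sZ1 _ cZ) (sY1 _ yY)].
exists T => //; split => //.
have unit_dist c (y : Y) : N c = 1 -> `|y| = 1 -> 2 - e <= `|lincomb g c - T y|.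
  move=> c1 y1.
  have [c' c'Z cc'] := netZ c c1; have [y' y'Y yy'] := netY y y1.
  have := sT _ (allpairs_f (fun c y => @rank1 R V n d (lincomb g c) y) c'Z y'Y).
  move=> /(rank1_dist LT T1 (sZ1 _ c'Z) (sY1 _ y'Y) h0 (ltW r0) hD) far.
  have dec : lincomb g c' - T y' =
      (lincomb g c - T y) - lincomb g (c - c') + T ((y : Y) - y').
    rewrite (is_linB linT) (is_linB LT.1) opprB.
    by rewrite (addrC (_ - T y)) subrKA subrKA.
  have Tyy : `|T ((y : Y) - y')| <= r.
    rewrite (le_trans (opn_le _ LT))// (le_trans _ yy')//.
    exact: ler_piMl (round_norm_ge0 _ _) T1.
  move: far; rewrite dec => /le_trans/(_ (ler_normD _ _)).
  have := ler_normB (lincomb g c - T y) (lincomb g (c - c')).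
  by rewrite -/(N (c - c')); lra.
move=> c y.
have [u u1 cE] := unit_multiple ND NZ N_eq0 c.
have [v v1 yE] := unit_multiple (@round_normD R n d) (@round_normZ R n d)
  (@round_norm_eq0 R n d) y.
(* [norm_comb_ge] extends the estimate from unit vectors to arbitrary lengths. *)
have -> : lincomb g c - T y = N c *: lincomb g u + `|y| *: - T v.
  rewrite {1}cE {1}yE (is_linZ linT) scalerN; congr (_ - _).
  exact: (is_linZ LT.1).
apply: norm_comb_ge => //; last 1 first.
- exact: ltW.
- by rewrite -/(N u) u1.
- by rewrite normrN (le_trans (opn_le _ LT))// -[`|v : Y|]/(round_norm d v) v1 mulr1.
- exact: unit_dist.
Qed.

(** Assertion (4) with a general [V] in place of the dual, the subspace being given by a spanning
    family that may be dependent. *)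
Definition ell1_absorbing (V : normedModType R) :=
  forall eps : R, 0 < eps -> forall k (f : 'I_k -> V) n,
    exists2 T : 'rV[R]_n -> V, Lop 'rV[R]_n V T & opn T <= 1 /\
      forall y c,
        (1 - eps) * (`|lincomb f c| + `|y|) <= `|lincomb f c + T y|.

Lemma absorbing_of_octahedral (V : normedModType R) :
  (exists v : V, v != 0) ->
  (forall n d, octahedral (@opn R (round_space n d) V) (Lop (round_space n d) V)) ->
  ell1_absorbing V.
Proof.
move=> [v v0] oct eps eps0 k f [|n].
  exists 0; first exact: Lop0.
  split=> [|y c].
    by apply: opn_ub => y y1; change (`|0 : V| <= 1); rewrite normr0.
  change ((1 - eps) * (`|lincomb f c| + `|y|) <= `|lincomb f c + (0 : V)|).
  rewrite (thinmx0 y) normr0 !addr0 ler_piMl// gerBl; exact: ltW.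
(* Adjoining the nonzero [v] makes the span nonzero, so the extracted free family is nonempty. *)
pose f' (i : 'I_k.+1) := if unlift ord0 i is Some j then f j else v.
have ff' c : exists c', lincomb f c = lincomb f' c'.
  exists (\row_i if unlift ord0 i is Some j then c ord0 j else 0).
  rewrite /lincomb big_ord_recl /= mxE /f' unlift_none scale0r add0r.
  by apply: eq_bigr => i _; rewrite mxE liftK.
have f'v : lincomb f' (delta_mx ord0 ord0) = v.
  rewrite /lincomb big_ord_recl /= mxE /f' unlift_none !eqxx scale1r big1 ?addr0//.
  by move=> i _; rewrite mxE /= scale0r.
have [[|l] [g [f'g gfree]]] := free_subfamily f'.
  have [c] := f'g (delta_mx ord0 ord0); rewrite f'v /lincomb big_ord0 => v00.
  by rewrite v00 eqxx in v0.
pose e : R := Num.min (eps / 2) 2^-1.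
have e0 : 0 < e by rewrite lt_min divr_gt0//= invr_gt0.
have e_eps : e <= eps / 2 by rewrite ge_min lexx.
have e_half : e <= 2^-1 by rewrite ge_min lexx orbT.
(* With [d = e / (n + 1)], the comparison constant in [round_le_norm] is [1 + e]. *)
have d0 : 0 < e / n.+1%:R by rewrite divr_gt0.
pose d := PosNum d0.
have K1 : 1 + d%:num * n.+1%:R = 1 + e by rewrite /= divfK// pnatr_eq0.
have K0 : 0 < 1 + e by lra.
have [T LT [T1 TV]] := round_operator (oct n d) gfree e0.
have Tle (y : 'rV[R]_n.+1) : `|T y| <= (1 + e) * `|y|.
  rewrite (le_trans (opn_le _ LT))// -K1; apply: le_trans (round_le_norm d y).
  by rewrite ler_piMl// round_norm_ge0.
(* Division by [1 + e] makes the operator a contraction for the max norm; the sign turns the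
   difference in [round_operator] into a sum. *)
exists (fun y => - (1 + e)^-1 *: T y).
  apply: (@LopP _ _ _ _ 1) => [a x y|y].
    by rewrite (LT.1 a) scalerDr !scalerA mulrC.
  by rewrite normrZ normrN gtr0_norm ?invr_gt0// mul1r ler_pdivrMl.
split.
  apply: opn_ub => y y1; rewrite normrZ normrN gtr0_norm ?invr_gt0//.
  by rewrite ler_pdivrMl// (le_trans (Tle y))// ler_wpM2l// ltW.
move=> y c; have [c' ->] := ff' c; have [b ->] := f'g c'.
have := TV b ((1 + e)^-1 *: y).
rewrite (is_linZ LT.1) -scaleNr; apply: le_trans.
have y_le : (1 - e) * `|y| <= `|(1 + e)^-1 *: (y : round_space n d)|.
  rewrite normrZ gtr0_norm ?invr_gt0//. rewrite ler_pdivlMl//.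
  apply: le_trans (norm_le_round d y).
  rewrite mulrA ler_piMl//; have := sqr_ge0 e; lra.
set a := `|lincomb g b|; have a0 : 0 <= a := normr_ge0 _.
(* The losses combine to [(1 - e)^2 >= 1 - 2 * e >= 1 - eps]. *)
apply: (@le_trans _ _ ((1 - e) * (a + (1 - e) * `|y|))); last first.
  by rewrite ler_pM2l ?lerD2l//; lra.
have := mulr_ge0 (sqr_ge0 e) (normr_ge0 y).
have := mulr_ge0 (normr_ge0 y) (ltW e0).
have := mulr_ge0 a0 (ltW e0).
have : 0 <= (eps - 2 * e) * (a + `|y|).
  by apply: mulr_ge0; [lra | exact: addr_ge0].
lra.
Qed.

(* [T] is a contraction because the l1-norm of the vector [(U e_j) a] equals
   [(U s) a] for a sign vector [s]. *)
Lemma octahedral_of_absorbing (X Y : normedModType R) (H : set (X -> Y)) :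
  ell1_absorbing (opSp X R) ->
  lsubspace H -> Fop X Y `<=` H -> H `<=` Lop X Y -> octahedral (@opn R X Y) H.
Proof.
move=> absX lH FH HL; apply: octahedral_ball => // n S eps eps0 S1.
(* The final bound is [2 * (1 - e)^2 >= 2 - 4 * e], whence [eps / 4]; [e <= 1/2] keeps [1 - e]
   positive. *)
pose e : R := Num.min (eps / 4) 2^-1.
have e0 : 0 < e by rewrite lt_min divr_gt0//= invr_gt0.
have e_eps : e <= eps / 4 by rewrite ge_min lexx.
have e_half : e <= 2^-1 by rewrite ge_min lexx orbT.
have LS i := HL _ (S1 i).1.
have /choice[x xP] i : exists x, `|x| <= 1 /\ 1 - e < `|S i x|.
  have [|x x1 xS] := @opn_gt _ _ _ (S i) (1 - e); first by rewrite (S1 i).2; lra.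
  by exists x.
have /choice[f fP] i := norming_functional (S i (x i)).
have Lz i : Lop X R (fun a => f i (S i a)).
  apply: (@LopP _ _ _ _ 1) => [a u v|u].
    by rewrite (LS i).1 (opfun_Lop (f i)).1.
  by rewrite (le_trans ((fP i).1 _))// -(S1 i).2 opn_le.
pose z i : opSp X R := mk_op (Lz i).
have zE i : lincomb z (delta_mx ord0 i) = z i.
  rewrite /lincomb (bigD1 i)//= mxE !eqxx scale1r big1 ?addr0// => j /negbTE ji.
  by rewrite mxE ji andbF scale0r.
have [U LU [U1 UV]] := absX e e0 _ z n.+1.
have UE (y : 'rV[R]_n.+1) a : U y a = \sum_j y ord0 j * U (delta_mx ord0 j) a.
  rewrite {1}(row_sum_delta y) (is_lin_sum LU.1).
  elim/big_ind2 : _ => [|A1 b1 A2 b2 <- <-|j _] //.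
  by rewrite (is_linZ LU.1).
have Sx1 j : `|S j (x j)| <= 1.
  by rewrite (le_trans (opn_le1 (LS j) (xP j).1))// (S1 j).2.
pose T a : Y := \sum_j U (delta_mx ord0 j) a *: S j (x j).
have T_le a : `|T a| <= `|a|.
  apply: (@le_trans _ _ (\sum_j `|U (delta_mx ord0 j) a|)).
    rewrite (le_trans (ler_norm_sum _ _ _))// ler_sum// => j _.
    by rewrite normrZ ler_piMr.
  pose s : 'rV[R]_n.+1 := \row_j Num.sg (U (delta_mx ord0 j) a).
  have s1 : `|s| <= 1.
    have [j ->] := norm_coord_ex s; rewrite mxE normr_sg.
    by case: (_ != 0); rewrite ?ler01.
  have -> : \sum_j `|U (delta_mx ord0 j) a| = U s a.
    by rewrite UE; apply: eq_bigr => j _; rewrite mxE normrEsg.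
  rewrite (le_trans (ler_norm _))// (le_trans (opn_le _ (opfun_Lop _)))//.
  rewrite ler_piMl// -norm_opSpE (le_trans (opn_le1 LU s1))//.
have LT : Lop X Y T.
  apply: (@LopP _ _ _ _ 1) => [c a b|a]; last by rewrite mul1r.
  rewrite /T scaler_sumr -big_split; apply: eq_bigr => j _ /=.
  by rewrite (opfun_Lop (U _)).1 scalerDl scalerA.
exists T; first apply: FH.
  split=> //; exists n.+1, (fun j => S j (x j)) => a.
  by exists (fun j => U (delta_mx ord0 j) a).
split; first by apply: opn_ub => a; exact: le_trans (T_le a).
(* The [i]-th coordinate of this [y] is [|S i (x i)|], so [|y|] is at least [1 - e]. *)
move=> i; pose y : 'rV[R]_n.+1 := \row_j f i (S j (x j)).
have y_ge : 1 - e <= `|y|.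
  rewrite (le_trans _ (coord_le_norm y i))// mxE (fP i).2 normr_id ltW//.
  exact: (xP i).2.
have z_ge : 1 - e <= `|z i|.
  rewrite norm_opSpE; have := opn_le1 (Lz i) (xP i).1.
  by apply: le_trans; rewrite (fP i).2 normr_id ltW// (xP i).2.
have zU : `|z i + U y| <= opn (S i + T).
  rewrite norm_opSpE; apply: opn_ub => a a1.
  rewrite (le_trans _ (opn_le1 (LopD (LS i) LT) a1))//.
  apply: le_trans ((fP i).1 _); rewrite (is_linD (opfun_Lop (f i)).1).
  have -> : f i (T a) = U y a.
    rewrite UE (is_lin_sum (opfun_Lop (f i)).1); apply: eq_bigr => j _.
    by rewrite mxE (is_linZ (opfun_Lop (f i)).1) mulrC.
  by [].
apply: le_trans zU; have := UV y (delta_mx ord0 i); rewrite zE.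
apply: le_trans; have : (1 - e) * ((1 - e) + (1 - e)) <= (1 - e) * (`|z i| + `|y|).
  by rewrite ler_wpM2l ?lerD//; lra.
apply: le_trans; have := sqr_ge0 e; lra.
Qed.

Lemma dual_neq0 (X : normedModType R) :
  (exists x : X, x != 0) -> exists f : opSp X R, f != 0.
Proof.
move=> [x x0]; have [f [_ fx]] := norming_functional x; exists f.
apply: contra_neq x0 => f0; apply/normr0_eq0.
by rewrite -fx f0.
Qed.

Lemma opfun_lincomb (X : normedModType R) k (f : 'I_k -> opSp X R) c :
  opfun (lincomb f c) = \sum_(i < k) c ord0 i *: (f i : X -> R).
Proof.
rewrite /lincomb; apply: (big_morph (@opfun R X R) (id1 := 0)) => //.
Qed.

End Absorption.

Theorem theorem5p2 (R : realType) (X : completeNormedModType R)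
  (hX : exists x : X, x != 0) :
  [<->
   (* (1) *)
   (forall (Y : completeNormedModType R) (H : set (X -> Y)),
      lsubspace H -> Fop X Y `<=` H -> H `<=` Lop X Y ->
      octahedral (@opn R X Y) H);
   (* (2) *)
   (forall Y : completeNormedModType R, octahedral (@opn R X Y) (Lop X Y));
   (* (3) X^star universally octahedral *)
   (forall Y : completeNormedModType R,
      octahedral (@opn_dual R Y X) (Lop_dual Y X));
   (* (4) *)
   (forall (eps : R), 0 < eps -> forall (Z : set (X -> R)),
      findim_dual_subspace Z -> forall n : nat,
      exists T : 'rV[R]_n -> (X -> R),
        Lop_dual 'rV[R]_n X T /\ opn_dual T <= 1 /\
        forall (y : 'rV[R]_n) (z : X -> R), Z z ->
          (1 - eps) * (dual_norm z + `|y|) <= dual_norm (z + T y))].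
Proof.
tfae.
- move=> H1 Y; apply: H1 => //; first exact: Lop_lsubspace.
  by move=> T [].
(* Assertion (2) is used with the complete target [opSp Y R]. *)
- by move=> H2 Y; apply/octahedral_dual/octahedral_flip/H2.
- move=> H3.
  (* Assertion (3) is applied to the complete spaces [round_space n d]. *)
  have absX := absorbing_of_octahedral (dual_neq0 hX)
    (fun n d => (octahedral_dual _ _).1 (H3 (round_space n d))).
  move=> eps eps0 Z [k [f [df ->]]] n; pose F i : opSp X R := mk_op (df i).
  have [T LT [T1 TV]] := absX eps eps0 k F n.
  exists (fun y => T y : X -> R); split; first exact/Lop_dualP.
  split=> // y z [c ->]; have := TV y (\row_i c i).
  have -> // : \sum_(i < k) c i *: f i = lincomb F (\row_i c i).
  by rewrite opfun_lincomb; apply: eq_bigr => i _; rewrite mxE.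
- move=> H4 Y H lH FH HL; apply: octahedral_of_absorbing => // eps eps0 k f n.
  have [|T [LT [T1 TV]]] := H4 eps eps0
      [set g | exists c : 'I_k -> R, g = \sum_(i < k) c i *: (f i : X -> R)] _ n.
    by exists k, (fun i => f i : X -> R); split=> // i; exact: opfun_Lop.
  have [T' LT' TE] := Lop_dual_ex LT; exists T' => //.
  split=> [|y c]; first by move: T1; rewrite TE.
  have := TV y (lincomb f c); rewrite TE; apply.
  by exists (fun i => c ord0 i); rewrite opfun_lincomb.
Qed.
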